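(* Let $A,B,C$ be rational with $$B<A<2B,\qquad 2B-A\le C\le B.$$ Then the target pair $$H_w=(0,A,A+B,A+2B),\qquad H_r=(0,A,A+C)$$ is realizable, and it has a globally coherent EC witness that admits no size completion preserving its values and identities. (In particular, no such pair is a pair satisfying EC that fails to be realizable.)
   Context: Instances and realizability. An instance consists of a finite set $E$ of items with rational values $a_i\ge 0$, positive integer sizes $d_i$, and integer capacities $0\le R<D$, with $d_i\le D$ for every item. Write $G(S)=\sum_{i\in S}a_i$ and $d(S)=\sum_{i\in S}d_i$. For $\alpha\in\{w,r\}$ let $U^\alpha(n)$ be the maximum of $G(S)$ over $n$-element sets $S\subseteq E$ with $d(S)\le D$ (for $\alpha=w$) or $d(S)\le R$ (for $\alpha=r$), with value $-\infty$ if there is none; $U^\alpha(0)=0$. The terminal count is $b_\alpha=\min\operatorname{arg\,max}_n U^\alpha(n)$. The hull is the sequence on $\{0,\dots,b_\alpha\}$ obtained by evaluating at integers the upper concave hull of the points $(n,U^\alpha(n))$, $0\le n\le b_\alpha$. A target pair $(H_w,H_r)$ consists of strictly increasing concave rational sequences $H_\alpha$ on $\{0,\dots,b_\alpha\}$ with $H_\alpha(0)=0$. It is realizable if a single instance has terminal counts $b_w,b_r$ and hulls exactly $H_w$ and $H_r$. There is no cardinality cap. Notation. $\rho_1=H_r(1)$ ($0$ if $b_r=0$); $\bar H_\alpha(k)=H_\alpha(\min\{k,b_\alpha\})$. A positive count $n\le b_\alpha$ is an $\alpha$-vertex if $n=b_\alpha$ or the slopes of $H_\alpha$ immediately before and after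 $n$ differ. Dominance means $H_r(k)\le\bar H_w(k)$ for $0\le k\le b_r$. EC witness. The pair satisfies EC if dominance holds and there is an admissible witness (an EC witness), consisting of: for each $w$-vertex $n$, an $n$-element labeled set $X_n$ with rational values $x_{n,i}$, a long/short label for each member, and a downward-closed family $\mathcal F_n$ of subsets of $X_n$ (the declared $r$-feasible subsets) containing $\varnothing$ and whose singletons are precisely the short members; for each $r$-vertex $m$, an $m$-element set $Z_m$ with rational values $z_{m,j}$; for each such $(n,m)$, a subset $O_{n,m}\subseteq X_n$ with $O_{n,m}\in\mathcal F_n$ and a map $\pi_{n,m}:O_{n,m}\to Z_m$; such that: (EC1) $0\le x_{n,i}\le H_w(1)$, short values are at most $\rho_1$, $\sum_i x_{n,i}=H_w(n)$; every $S\subseteq X_n$ has total value at most $\bar H_w(|S|)$, and every $S\in\mathcal F_n$ has total value at most $\bar H_r(|S|)$. (EC2) $0\le z_{m,j}\le\rho_1$, $\sum_j z_{m,j}=H_r(m)$, and every $S\subseteq Z_m$ has total value at most $\bar H_r(|S|)$. (EC3) $\pi_{n,m}$ is injective, $O_{n,m}$ contains only short members, and $x_{n,i}=z_{m,\pi_{n,m}(i)}$ for $i\in O_{n,m}$. (EC4) For every $(n,m)$ and every long $i\in X_n$, with $k=|O_{n,m}|$, $\bar H_w(n-1+m-k)\ge H_w(n)-x_{n,i}+H_r(m)-\sum_{i'\in O_{n,m}}z_{m,\pi_{n,m}(i')}$. (EC5) For every $(n,m)$, every two-element subset $\{i,i'\}\subseteq X_n$ with $\{i,i'\}\notin\mathcal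 F_n$, and every $y\in X_n\setminus(\{i,i'\}\cup O_{n,m})$, $\bar H_w(m+1)\ge x_{n,y}+H_r(m)$. Global coherence. An EC witness is globally coherent if one ground set $E$ (of items with values) contains every $X_n$ and every $Z_m$, and all maps $\pi_{n,m}$ are restrictions of item identity on $E$. Size completion. A size completion (preserving values and identities) of a globally coherent EC witness on $E$ is a choice of positive rational sizes $d_i$ ($i\in E$) and rational capacities $0\le R<D$ such that $d_i\le D$ for every $i\in E$; $d(X_n)\le D$ for every $w$-vertex $n$; $d(Z_m)\le R$ for every $r$-vertex $m$; for each $n$, a subset $S\subseteq X_n$ satisfies $d(S)\le R$ if and only if $S\in\mathcal F_n$; every $S\subseteq E$ with $d(S)\le D$ satisfies $G(S)\le\bar H_w(|S|)$; and every $S\subseteq E$ with $d(S)\le R$ satisfies $G(S)\le\bar H_r(|S|)$. *)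

(* Defs.v *)
From mathcomp Require Import all_boot all_order all_algebra.
From mathcomp Require Import constructive_ereal.

Set Implicit Arguments.
Unset Strict Implicit.
Unset Printing Implicit Defensive.

Import Order.TTheory GRing.Theory Num.Theory.
Local Open Scope ring_scope.

Record instance := Instance {
  item : finType;
  value : item -> rat;
  isize : item -> nat;
  capR : nat;
  capD : nat;
  value_ge0 : forall i, 0 <= value i;
  isize_gt0 : forall i, (0 < isize i)%N;
  capR_lt_capD : (capR < capD)%N;
  isize_le_capD : forall i, (isize i <= capD)%N }.

(* Capacity c = capD I gives U^w and c = capR I gives U^r. *)
Definition U (I : instance) (c n : nat) : \bar rat :=
  (\big[maxe/-oo]_(S : {set item I} | (#|S| == n) && (\sum_(i in S) isize i <= c)%N)
     (\sum_(i in S) value i)%:E)%E.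

Definition is_terminal_count (u : nat -> \bar rat) (b : nat) : Prop :=
  (forall m, (u m <= u b)%E) /\
  (forall n, (forall m, (u m <= u n)%E) -> (b <= n)%N).

Definition hull_weights (b k : nat) (l : 'I_b.+1 -> rat) : Prop :=
  [/\ forall i, 0 <= l i, \sum_i l i = 1 & \sum_i l i * i%:R = k%:R].

(* h is the largest ordinate over abscissa k in the convex hull of the points
   (i, u i), 0 <= i <= b. Since 0 * -oo = 0, a point with u i = -oo contributes
   exactly when its weight is positive. *)
Definition is_hull_value (u : nat -> \bar rat) (b k : nat) (h : rat) : Prop :=
  (exists2 l : 'I_b.+1 -> rat, hull_weights k l &
     (\sum_(i < b.+1) (l i)%:E * u i)%E = h%:E) /\
  (forall l : 'I_b.+1 -> rat, hull_weights k l ->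
     (\sum_(i < b.+1) (l i)%:E * u i <= h%:E)%E).

(* A sequence (H(0), ..., H(b)) is a list of length b + 1. *)
Definition term (H : seq rat) : nat := (size H).-1.

Definition bar (H : seq rat) (k : nat) : rat := H`_(minn k (term H)).

Definition target_seq (H : seq rat) : Prop :=
  [/\ (0 < size H)%N, H`_0 = 0,
      forall k, (k < term H)%N -> H`_k < H`_k.+1 &
      forall k, (k.+1 < term H)%N -> H`_k.+2 - H`_k.+1 <= H`_k.+1 - H`_k].

Definition target_pair (Hw Hr : seq rat) : Prop := target_seq Hw /\ target_seq Hr.

Definition has_hull (u : nat -> \bar rat) (H : seq rat) : Prop :=
  is_terminal_count u (term H) /\
  forall k, (k <= term H)%N -> is_hull_value u (term H) k H`_k.

Definition realizable (Hw Hr : seq rat) : Prop :=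
  exists I : instance, has_hull (U I (capD I)) Hw /\ has_hull (U I (capR I)) Hr.

Definition rho1 (Hr : seq rat) : rat := if term Hr == 0%N then 0 else Hr`_1.

Definition vertex (H : seq rat) (n : nat) : bool :=
  (0 < n <= term H)%N &&
  ((n == term H) || (H`_n - H`_n.-1 != H`_n.+1 - H`_n)).

Definition dominance (Hw Hr : seq rat) : Prop :=
  forall k, (k <= term Hr)%N -> Hr`_k <= bar Hw k.

(* All the sets X_n and Z_m are taken inside one finite type of labels. Labels
   carry no meaning by themselves (the values depend on n and m, and pi need not
   be the identity); only [coherent] below turns them into items. The data at
   indices that are not vertices, and functions outside their domains X_n, Z_m,
   O_(n,m), are irrelevant. *)
Record witness (E : finType) := Witness {
  wX : nat -> {set E};
  wx : nat -> E -> rat;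
  wlong : nat -> pred E;
  wF : nat -> {set {set E}};
  wZ : nat -> {set E};
  wz : nat -> E -> rat;
  wO : nat -> nat -> {set E};
  wpi : nat -> nat -> E -> E }.

Section EC.
Variables (Hw Hr : seq rat) (E : finType) (W : witness E).

Record w_data (n : nat) : Prop := WData {
  card_X : #|wX W n| = n;
  F_sub : forall S, S \in wF W n -> S \subset wX W n;
  F_down : forall S T : {set E}, S \in wF W n -> T \subset S -> T \in wF W n;
  F_set0 : set0 \in wF W n;
  F_single : forall i, ([set i] \in wF W n) = (i \in wX W n) && ~~ wlong W n i }.

Record o_data (n m : nat) : Prop := OData {
  O_sub : wO W n m \subset wX W n;
  O_F : wO W n m \in wF W n;
  pi_Z : {in wO W n m, forall i, wpi W n m i \in wZ W m} }.

Record EC1 (n : nat) : Prop := MkEC1 {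
  EC1_range : {in wX W n, forall i, 0 <= wx W n i <= Hw`_1};
  EC1_short : {in wX W n, forall i, ~~ wlong W n i -> wx W n i <= rho1 Hr};
  EC1_sum : \sum_(i in wX W n) wx W n i = Hw`_n;
  EC1_w : forall S : {set E}, S \subset wX W n -> \sum_(i in S) wx W n i <= bar Hw #|S|;
  EC1_r : forall S : {set E}, S \in wF W n -> \sum_(i in S) wx W n i <= bar Hr #|S| }.

Record EC2 (m : nat) : Prop := MkEC2 {
  EC2_range : {in wZ W m, forall j, 0 <= wz W m j <= rho1 Hr};
  EC2_sum : \sum_(j in wZ W m) wz W m j = Hr`_m;
  EC2_r : forall S : {set E}, S \subset wZ W m -> \sum_(j in S) wz W m j <= bar Hr #|S| }.

Record EC3 (n m : nat) : Prop := MkEC3 {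
  EC3_inj : {in wO W n m &, injective (wpi W n m)};
  EC3_short : {in wO W n m, forall i, ~~ wlong W n i};
  EC3_val : {in wO W n m, forall i, wx W n i = wz W m (wpi W n m i)} }.

Definition EC4 (n m : nat) : Prop :=
  forall i, i \in wX W n -> wlong W n i ->
  Hw`_n - wx W n i + Hr`_m - \sum_(j in wO W n m) wz W m (wpi W n m j)
    <= bar Hw (n.-1 + m - #|wO W n m|)%N.

Definition EC5 (n m : nat) : Prop :=
  forall i i' y, i \in wX W n -> i' \in wX W n -> i != i' ->
  [set i; i'] \notin wF W n ->
  y \in wX W n :\: ([set i; i'] :|: wO W n m) ->
  wx W n y + Hr`_m <= bar Hw m.+1.

Record EC_witness : Prop := MkECWitness {
  ECW_w : forall n, vertex Hw n -> w_data n /\ EC1 n;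
  ECW_r : forall m, vertex Hr m -> #|wZ W m| = m /\ EC2 m;
  ECW_wr : forall n m, vertex Hw n -> vertex Hr m ->
    [/\ o_data n m, EC3 n m, EC4 n m & EC5 n m] }.

(* E itself is the ground set, with item values a. The last clause says that E
   has no items besides those of the sets X_n and Z_m; otherwise an irrelevant
   extra item of huge value would rule out size completions vacuously. *)
Record coherent (a : E -> rat) : Prop := MkCoherent {
  coh_x : forall n, vertex Hw n -> {in wX W n, forall i, wx W n i = a i};
  coh_z : forall m, vertex Hr m -> {in wZ W m, forall j, wz W m j = a j};
  coh_pi : forall n m, vertex Hw n -> vertex Hr m ->
    {in wO W n m, forall i, wpi W n m i = i};
  coh_cover : forall e, (exists2 n, vertex Hw n & e \in wX W n) \/
                        (exists2 m, vertex Hr m & e \in wZ W m) }.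

Record size_completion (a d : E -> rat) (R D : rat) : Prop := MkSizeCompletion {
  sc_pos : forall i, 0 < d i;
  sc_cap : 0 <= R < D;
  sc_le : forall i, d i <= D;
  sc_X : forall n, vertex Hw n -> \sum_(i in wX W n) d i <= D;
  sc_Z : forall m, vertex Hr m -> \sum_(j in wZ W m) d j <= R;
  sc_F : forall n, vertex Hw n -> forall S : {set E}, S \subset wX W n ->
    (\sum_(i in S) d i <= R <-> S \in wF W n);
  sc_w : forall S : {set E}, \sum_(i in S) d i <= D -> \sum_(i in S) a i <= bar Hw #|S|;
  sc_r : forall S : {set E}, \sum_(i in S) d i <= R -> \sum_(i in S) a i <= bar Hr #|S| }.

End EC.

Definition satisfies_EC (Hw Hr : seq rat) : Prop :=
  dominance Hw Hr /\ exists (E : finType) (W : witness E), EC_witness Hw Hr W.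

(* Main.v *)
Require Import Defs.
From mathcomp Require Import all_boot all_order all_algebra.
From mathcomp Require Import constructive_ereal lra zify.

Import Order.TTheory GRing.Theory Num.Theory.
Local Open Scope ring_scope.

(** The obstruction is a conflict between labels that no EC condition compares.
    Take two distinct items alpha and p of value A, two items q and r of value B
    and one item v of value C, and set

      X_1 = {alpha},  X_3 = {p, q, r},  Z_1 = {p},  Z_2 = {p, v},

    with every item short and no pair declared r-feasible. As EC4 concerns long
    items, the condition at stake is EC5. It asks x_(3,y) <= B of the items y
    outside O_(3,m), so it could only reject y = p against the pair {q, r}, and p
    escapes because it lies in O_(3,1) and O_(3,2). The sets X_1 and X_3, however,
    are tied together by sizes. The pair {alpha, p} is worth 2A > A + B, so a size
    completion needs d(alpha) + d(p) > D >= d(p) + d(q) + d(r), hence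
    d(alpha) > d(q) + d(r); but alpha is short, so d(alpha) <= R, while {q, r} is
    not r-feasible, so d(q) + d(r) > R ([no_size_completion]).

    Dropping the demand that alpha be short removes the conflict: the sizes
    5, 1, 2, 2, 1 of alpha, p, q, r, v with R = 2 and D = 5 make the same five
    items with the same values realize the pair ([realizable_pair]). The optimal
    values are then the target sequences themselves, and a concave sequence is
    its own hull ([hull_of_target_seq]). *)

(** * Sequences that are their own hull *)

Lemma barE (H : seq rat) k : bar H k = nth (last 0 H) H k.
Proof.
rewrite /bar /term /minn; case: H => [|h H] /=; first by rewrite !nth_nil.
case: ltnP => [lt_k | ge_k]; first by apply: set_nth_default; rewrite ltnW.
case: (eqVneq k (size H)) => [-> | ne_k].
  exact: set_nth_default.
by rewrite -(last_nth 0) nth_default //= ltn_neqAle eq_sym ne_k.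
Qed.

Lemma target_seq_mono (H : seq rat) i j :
  target_seq H -> (i <= j <= term H)%N -> H`_i <= H`_j.
Proof.
case=> _ _ Hinc _ /andP[le_ij]; rewrite -(subnK le_ij).
elim: (j - i)%N => [|d IHd] //= le_d.
by apply: le_trans (IHd (ltnW le_d)) (ltW (Hinc _ le_d)).
Qed.

Lemma target_seq_slope (H : seq rat) i j :
  target_seq H -> (i <= j < term H)%N -> H`_j.+1 - H`_j <= H`_i.+1 - H`_i.
Proof.
case=> _ _ _ Hconc /andP[le_ij]; rewrite -(subnK le_ij).
elim: (j - i)%N => [|d IHd] //= lt_d.
by apply: le_trans (Hconc _ lt_d) (IHd (ltnW lt_d)).
Qed.

(** A concave sequence has a supporting line at every index: the slope of the
    next step, and at the last index, since the sequence increases, slope 0. *)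
Lemma target_seq_support {H : seq rat} {k} : target_seq H -> (k <= term H)%N ->
  exists s, forall i, (i <= term H)%N -> H`_i <= H`_k + s * (i%:R - k%:R).
Proof.
move=> tH; rewrite leq_eqVlt => /orP[/eqP-> | lt_k].
  exists 0 => i le_i; rewrite mul0r addr0.
  by apply: target_seq_mono; rewrite ?le_i ?leqnn.
exists (H`_k.+1 - H`_k) => i le_i; case: (leqP k i) => [le_ki | /ltnW le_ik].
  move: le_i; rewrite -(subnK le_ki).
  elim: (i - k)%N => [|d IHd] le_d; first by rewrite add0n subrr mulr0 addr0.
  have := IHd (ltnW le_d).
  have /(target_seq_slope _ _ _ tH): (k <= d + k < term H)%N by rewrite leq_addl.
  by rewrite addSn -[(d + k).+1%:R]natr1; lra.
have: (k - (k - i) <= k)%N by rewrite leq_subr.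
rewrite -{2 3}(subKn le_ik).
elim: (k - i)%N => [|d IHd] _; first by rewrite subn0 subrr mulr0 addr0.
have {IHd}IH := IHd (leq_subr _ _).
case: (posnP (k - d)%N) => [e0 | gt0]; first by rewrite subnS e0 /= -e0.
have /(target_seq_slope _ _ _ tH): ((k - d).-1 <= k < term H)%N by lia.
rewrite subnS; case: (k - d)%N gt0 IH => // e _.
by rewrite -natr1 /=; lra.
Qed.

(** The weights of a convex combination average the supporting line at k to its
    value at k, so no combination of points of H rises above H. *)
Lemma hull_of_target_seq (u : nat -> \bar rat) (H : seq rat) :
  target_seq H -> (forall k, (k <= term H)%N -> u k = (H`_k)%:E) ->
  (forall k, (term H < k)%N -> (u k <= u (term H))%E) -> has_hull u H.
Proof.
move=> tH uH u_late; split.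
  split=> [m | n max_n].
    case: (leqP m (term H)) => [le_m | /u_late //].
    by rewrite !uH // lee_fin target_seq_mono // le_m leqnn.
  rewrite leqNgt; apply/negP=> lt_n.
  have := max_n n.+1; rewrite !uH ?(ltnW lt_n) // lee_fin leNgt.
  by case: tH => _ _ -> .
move=> k le_k.
have sumE (l : 'I_(term H).+1 -> rat) :
    (\sum_(i < (term H).+1) (l i)%:E * u i)%E = (\sum_i l i * H`_i)%:E.
  by rewrite -sumEFin; apply: eq_bigr => i _; rewrite uH ?EFinM // -ltnS.
split.
  pose ki : 'I_(term H).+1 := Ordinal (le_k : (k < (term H).+1)%N).
  have pick (f : 'I_(term H).+1 -> rat) : \sum_i (i == ki)%:R * f i = f ki.
    rewrite (bigD1 ki) //= eqxx mul1r big1 ?addr0 // => i /negbTE->.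
    by rewrite mul0r.
  exists (fun i => (i == ki)%:R); last by rewrite sumE pick.
  split=> [i||]; rewrite ?ler0n ?pick //.
  by under eq_bigr do rewrite -[_%:R]mulr1; rewrite pick.
move=> l [l_ge0 l_sum l_mean]; rewrite sumE lee_fin.
have [s Hs] := target_seq_support tH le_k.
apply: (@le_trans _ _ (\sum_i l i * (H`_k + s * (i%:R - k%:R)))).
  by apply: ler_sum => i _; rewrite ler_wpM2l // Hs // -ltnS.
under eq_bigr do rewrite mulrDr mulrBr mulrBr.
have shift (c : rat) (f : 'I_(term H).+1 -> rat) :
    \sum_i l i * (c * f i) = c * \sum_i l i * f i.
  by rewrite mulr_sumr; apply: eq_bigr => i _; rewrite mulrCA.
rewrite big_split sumrB /= shift -!mulr_suml l_sum l_mean.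
by lra.
Qed.

Lemma U_le (I : instance) c n g :
  (forall S : {set item I}, #|S| = n -> (\sum_(i in S) isize i <= c)%N ->
     \sum_(i in S) value i <= g) ->
  (U I c n <= g%:E)%E.
Proof.
move=> le_g; apply/bigmax_leP; split=> [|S /andP[/eqP cS dS]]; first exact: leNye.
by rewrite lee_fin le_g.
Qed.

(** Reduces a statement about optima and hulls to single sets. The upper bound is
    the one that a size completion imposes on all feasible sets. *)
Lemma has_hull_of_tight_bound (I : instance) c (H : seq rat) :
  target_seq H ->
  (forall S : {set item I}, (\sum_(i in S) isize i <= c)%N ->
     \sum_(i in S) value i <= bar H #|S|) ->
  (forall k, (k <= term H)%N -> exists S : {set item I},
     [/\ #|S| = k, (\sum_(i in S) isize i <= c)%N
       & \sum_(i in S) value i = H`_k]) ->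
  has_hull (U I c) H.
Proof.
move=> tH bound tight.
have U_bar k : (U I c k <= (bar H k)%:E)%E.
  by apply: U_le => S <-; apply: bound.
have U_term k : (k <= term H)%N -> U I c k = (H`_k)%:E.
  move=> le_k; apply/le_anti/andP; split.
    by have := U_bar k; rewrite /bar (minn_idPl le_k).
  have [S [cS dS <-]] := tight _ le_k.
  by apply: le_bigmax_cond; rewrite cS eqxx.
apply: hull_of_target_seq => // k lt_k; rewrite (U_term _ (leqnn _)).
by have := U_bar k; rewrite /bar (minn_idPr (ltnW lt_k)).
Qed.

(** * The five items *)

Definition alpha : 'I_5 := @Ordinal 5 0 isT.
Definition p : 'I_5 := @Ordinal 5 1 isT.
Definition q : 'I_5 := @Ordinal 5 2 isT.
Definition r : 'I_5 := @Ordinal 5 3 isT.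
Definition v : 'I_5 := @Ordinal 5 4 isT.

(** Stated for an arbitrary monoid, so that it serves values, sizes and counts;
    it turns every question about subsets into a finite case analysis. *)
Lemma big_items (T : Type) (idx : T) (op : Monoid.law idx) (f : 'I_5 -> T)
    (S : {pred 'I_5}) :
  \big[op/idx]_(i in S) f i =
    op (if alpha \in S then f alpha else idx)
   (op (if p \in S then f p else idx)
   (op (if q \in S then f q else idx)
   (op (if r \in S then f r else idx) (if v \in S then f v else idx)))).
Proof.
have e1 : lift ord0 ord0 = p by apply: val_inj.
have e2 : lift ord0 (lift ord0 ord0) = q by apply: val_inj.
have e3 : lift ord0 (lift ord0 (lift ord0 ord0)) = r by apply: val_inj.
have e4 : lift ord0 (lift ord0 (lift ord0 (lift ord0 ord0))) = v.
  exact: val_inj.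
have e0 : ord0 = alpha by apply: val_inj.
by rewrite big_mkcond !big_ord_recl big_ord0 Monoid.mulm1 e4 e3 e2 e1 e0.
Qed.

Lemma itemP (i : 'I_5) : [\/ i = alpha, i = p, i = q | i = r \/ i = v].
Proof.
case: i => -[|[|[|[|[|//]]]]] lt_i;
  [constructor 1|constructor 2|constructor 3|constructor 4; left
  |constructor 4; right]; exact: val_inj.
Qed.

Definition item_value (A B C : rat) (i : 'I_5) : rat := [:: A; A; B; B; C]`_i.

(** * Realization *)

(** With R = 2 and D = 5, alpha fills D alone, {p, q, r} fills D and {p, v} fills
    R. The size 2 of q and r keeps the pairs {p, q} and {p, r} above R. *)
Definition item_size (i : 'I_5) : nat := nth 0%N [:: 5; 1; 2; 2; 1]%N i.

Lemma item_size_range i : (0 < item_size i <= 5)%N.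
Proof. by case: (itemP i) => [ | | | [] ] ->. Qed.

Lemma item_value_ge0 (A B C : rat) i :
  0 <= A -> 0 <= B -> 0 <= C -> 0 <= item_value A B C i.
Proof. by case: (itemP i) => [ | | | [] ] ->. Qed.

Definition five_item_instance (A B C : rat)
    (hA : 0 <= A) (hB : 0 <= B) (hC : 0 <= C) :=
  @Instance 'I_5 (item_value A B C) item_size 2 5
    (fun i => item_value_ge0 A B C i hA hB hC)
    (fun i => proj1 (andP (item_size_range i))) isT
    (fun i => proj2 (andP (item_size_range i))).

Lemma target_w (A B : rat) :
  0 < B -> B < A -> target_seq [:: 0; A; A + B; A + 2 * B].
Proof.
move=> B_gt0 hBA; split=> //.
  by case=> [|[|[|k]]] //= _; lra.
by case=> [|[|k]] //= _; lra.
Qed.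

Lemma target_r (A C : rat) : 0 < C -> C < A -> target_seq [:: 0; A; A + C].
Proof.
move=> C_gt0 hCA; split=> //.
  by case=> [|[|k]] //= _; lra.
by case=> [|k] //= _; lra.
Qed.

Lemma realizable_pair (A B C : rat) : B < A -> A < 2 * B -> 0 < C -> C <= B ->
  realizable [:: 0; A; A + B; A + 2 * B] [:: 0; A; A + C].
Proof.
move=> hBA hA2B C_gt0 hCB.
have hA : 0 <= A by lra.
have hB : 0 <= B by lra.
exists (five_item_instance A B C hA hB (ltW C_gt0)).
split; apply: has_hull_of_tight_bound => /=.
- by apply: target_w; lra.
- move=> S; rewrite barE -sum1_card !big_items.
  by do 5![case: (_ \in S)] => //= _; rewrite /item_value /=; lra.
- case=> [|[|[|[|//]]]] _;
    [exists set0 | exists [set p] | exists [set p; q] | exists [set p; q; r]];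
    rewrite -sum1_card !big_items !inE /item_value /=; split=> //; lra.
- by apply: target_r; lra.
- move=> S; rewrite barE -sum1_card !big_items.
  by do 5![case: (_ \in S)] => //= _; rewrite /item_value /=; lra.
- case=> [|[|[|//]]] _; [exists set0 | exists [set p] | exists [set p; v]];
    rewrite -sum1_card !big_items !inE /item_value /=; split=> //; lra.
Qed.

(** * A witness without a size completion *)

Definition X (n : nat) : {set 'I_5} :=
  if n == 1%N then [set alpha] else [set p; q; r].

Definition Z (m : nat) : {set 'I_5} :=
  if m == 1%N then [set p] else [set p; v].

Definition no_pair_witness (A B C : rat) : witness 'I_5 :=
  {| wX := X;
     wx := fun _ => item_value A B C;
     wlong := fun _ => pred0;
     wF := fun n => [set S : {set 'I_5} | S \subset X n & (#|S| <= 1)%N];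
     wZ := Z;
     wz := fun _ => item_value A B C;
     wO := fun n _ => if n == 1%N then set0 else [set p];
     wpi := fun _ _ => id |}.

Lemma vertex_w (A B : rat) n :
  vertex [:: 0; A; A + B; A + 2 * B] n -> n = 1%N \/ n = 3%N.
Proof.
case: n => [|[|[|[|n]]]]; rewrite /vertex /term //=; try by [left | right].
(* At n = 2 both slopes are B. *)
by move/eqP=> ne; exfalso; apply: ne; lra.
Qed.

Lemma vertex_r (A C : rat) m : vertex [:: 0; A; A + C] m -> m = 1%N \/ m = 2%N.
Proof. by case: m => [|[|[|m]]]; rewrite /vertex /term //=; [left | right]. Qed.

Lemma vertex_w1 (A B : rat) : B < A -> vertex [:: 0; A; A + B; A + 2 * B] 1.
Proof. by move=> hBA; rewrite /vertex /term /=; apply/eqP; lra. Qed.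

Lemma not_mem_sub (S T : {set 'I_5}) i :
  S \subset T -> i \notin T -> (i \in S) = false.
Proof. by move=> /subsetP ST iT; apply/negP=> /ST; apply/negP. Qed.

(** Declaring as few feasible sets as possible leaves the bounds by H_r nothing to
    check beyond single values. The price is EC5, whose conclusion for an item of
    value B is A + B <= H_w(2) when m = 1 and A + B + C <= H_w(3) when m = 2; the
    latter is C <= B. *)
Lemma EC_no_pair_witness (A B C : rat) : B < A -> A < 2 * B -> 0 < C -> C <= B ->
  EC_witness [:: 0; A; A + B; A + 2 * B] [:: 0; A; A + C] (no_pair_witness A B C).
Proof.
move=> hBA hA2B C_gt0 hCB; split.
- move=> n Vn; split.
    split=> /=.
    + rewrite -sum1_card big_items /X.
      by case: (vertex_w _ _ _ Vn) => ->; rewrite !inE.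
    + by move=> S; rewrite inE => /andP[].
    + move=> S T; rewrite !inE => /andP[SX S1] TS.
      by rewrite (subset_trans TS SX) (leq_trans (subset_leq_card TS) S1).
    + by rewrite inE sub0set cards0.
    + by move=> i; rewrite inE sub1set cards1 !andbT.
  split=> /=.
  + by move=> i _; case: (itemP i) => [ | | | [] ] ->; rewrite /item_value /=; lra.
  + move=> i _ _; rewrite /rho1.
    by case: (itemP i) => [ | | | [] ] ->; rewrite /item_value /=; lra.
  + rewrite big_items /X; case: (vertex_w _ _ _ Vn) => ->;
      rewrite !inE /item_value /=; lra.
  + move=> S SX; rewrite barE -sum1_card !big_items.
    have vS : (v \in S) = false.
      by apply: not_mem_sub SX _; rewrite /X; case: ifP; rewrite !inE.
    rewrite vS.
    have [aS | bS] : alpha \in S = false \/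
        [/\ p \in S = false, q \in S = false & r \in S = false].
      case: (vertex_w _ _ _ Vn) SX => -> SX; [right | left];
        rewrite ?(not_mem_sub _ _ _ SX) ?inE //.
    * rewrite aS.
      by do 3![case: (_ \in S)]; rewrite /item_value /=; lra.
    * case: bS => -> -> ->; case: (_ \in S); rewrite /item_value /=; lra.
  + move=> S; rewrite inE => /andP[_]; rewrite barE -sum1_card !big_items.
    by do 5![case: (_ \in S)] => //= _; rewrite /item_value /=; lra.
- move=> m Vm; split=> /=.
    rewrite -sum1_card big_items /Z.
    by case: (vertex_r _ _ _ Vm) => ->; rewrite !inE.
  split=> /=.
  + move=> i _; rewrite /rho1.
    by case: (itemP i) => [ | | | [] ] ->; rewrite /item_value /=; lra.
  + rewrite big_items /Z; case: (vertex_r _ _ _ Vm) => ->;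
      rewrite !inE /item_value /=; lra.
  + move=> S SZ; rewrite barE -sum1_card !big_items.
    have out i : i \notin [set p; v] -> (i \in S) = false.
      move=> i_out; apply: not_mem_sub SZ _; apply: contra i_out.
      by rewrite /Z; case: ifP; rewrite !inE // => _ ->.
    rewrite (out alpha) ?(out q) ?(out r) ?inE //.
    by do 2![case: (_ \in S)]; rewrite /item_value /=; lra.
- move=> n m Vn Vm; split.
  + split=> /=.
    * by rewrite /X; case: ifP => _; rewrite ?sub0set ?sub1set ?inE.
    * rewrite /X inE; case: ifP => _; first by rewrite sub0set cards0.
      by rewrite sub1set cards1 !inE.
    * by move=> i; rewrite /Z; case: ifP; case: ifP; rewrite !inE // => _ _ ->.
  + by split.
  + by [].
  + move=> i j y /=; case: (vertex_w _ _ _ Vn) => -> /=.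
      by rewrite /X /= !inE => /eqP-> /eqP->; rewrite eqxx.
    (* As p lies in O_(3,m), the remaining y is q or r. *)
    move=> _ _ _ _; rewrite /X !inE !negb_or -!andbA.
    move=> /and4P[_ _ /negbTE-> /= Hy].
    have -> : item_value A B C y = B by case/orP: Hy => /eqP->.
    by rewrite barE; case: (vertex_r _ _ _ Vm) => -> /=; lra.
Qed.

Lemma no_pair_witness_coherent (A B C : rat) : B < A ->
  coherent [:: 0; A; A + B; A + 2 * B] [:: 0; A; A + C] (no_pair_witness A B C)
    (item_value A B C).
Proof.
move=> hBA; split=> // i.
case: (itemP i) => [ | | | [] ] -> /=.
- by left; exists 1%N; rewrite ?vertex_w1 ?inE.
- by left; exists 3%N; rewrite ?inE.
- by left; exists 3%N; rewrite ?inE.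
- by left; exists 3%N; rewrite ?inE.
- by right; exists 2%N; rewrite ?inE.
Qed.

(** The sets {alpha, p} and {p, q, r} share p, so comparing them forces
    d(alpha) > d(q) + d(r), against the labels of alpha and {q, r}. *)
Lemma no_size_completion (A B C : rat) : B < A ->
  ~ exists (d : 'I_5 -> rat) (R D : rat),
    size_completion [:: 0; A; A + B; A + 2 * B] [:: 0; A; A + C]
      (no_pair_witness A B C) (item_value A B C) d R D.
Proof.
move=> hBA [d [R [D sc]]].
have V3 : vertex [:: 0; A; A + B; A + 2 * B] 3 by [].
have alpha_short : d alpha <= R.
  have /(sc_F sc (vertex_w1 _ _ hBA)) : [set alpha] \subset X 1 by [].
  by rewrite big_set1 => -[_]; apply; rewrite inE cards1 subxx.
have qr_infeasible : R < d q + d r.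
  have /(sc_F sc V3) : [set q; r] \subset X 3.
    by apply/subsetP=> i; rewrite !inE => /orP[] ->; rewrite ?orbT.
  rewrite ltNge inE cards2 andbF big_items !inE /= !add0r addr0.
  by move=> [qr_F _]; apply/negP=> /qr_F.
have X3_fits : d p + d q + d r <= D.
  by have := sc_X sc V3; rewrite big_items !inE /=; lra.
have alpha_p_fits : \sum_(i in [set alpha; p]) d i <= D.
  by rewrite big_items !inE /=; lra.
(* The value 2A of {alpha, p} exceeds H_w(2) = A + B. *)
have := sc_w sc alpha_p_fits.
by rewrite cards2 barE big_items !inE /item_value /=; lra.
Qed.

Theorem theorem5p2 (A B C : rat)
    (hBA : B < A) (hA2B : A < 2 * B) (hCl : 2 * B - A <= C) (hCu : C <= B) :
  let Hw := [:: 0; A; A + B; A + 2 * B] in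
  let Hr := [:: 0; A; A + C] in
  [/\ target_pair Hw Hr,
      realizable Hw Hr,
      exists (E : finType) (W : witness E) (a : E -> rat),
        [/\ EC_witness Hw Hr W,
            coherent Hw Hr W a &
            ~ exists (d : E -> rat) (R D : rat), size_completion Hw Hr W a d R D] &
      ~ (satisfies_EC Hw Hr /\ ~ realizable Hw Hr)].
Proof.
move=> Hw Hr.
have C_gt0 : 0 < C by lra.
have Hreal : realizable Hw Hr by apply: realizable_pair.
split=> //; last by case.
  by split; [apply: target_w | apply: target_r]; lra.
exists 'I_5, (no_pair_witness A B C), (item_value A B C); split.
- exact: EC_no_pair_witness.
- exact: no_pair_witness_coherent.
- exact: no_size_completion.
Qed.
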